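(* Let $R = [0,1]^k$ and let $f_0, f_1, \ldots, f_n : R \to \mathbb{R}$ be linearly independent real analytic functions. Put $$\mathcal{C} = \{\, \{x \in R : f_0(x) - f(x) > 0\} \;:\; f \in \mathrm{span}\langle f_1, \ldots, f_n\rangle \,\}.$$ For $N > n$, let $\nu$ be a probability measure on $R^N$ which is absolutely continuous with respect to Lebesgue measure. If $q = (q_1, \ldots, q_N) \in R^N$ is selected at random according to $\nu$, then with probability $1$ the set system $\mathcal{C}\vert_{X_0}$ is maximum of VC dimension $n$ (as a set system on $X_0$), where $X_0 = \{q_1, \ldots, q_N\} \subseteq R$.
   Context: Spans are over $\mathbb{R}$; $R^N \subseteq \mathbb{R}^{kN}$ carries Lebesgue measure $\lambda$. A measure $\nu$ defined on the Borel sets is absolutely continuous with respect to $\lambda$ if $\lambda(B) = 0$ always implies $\nu(B) = 0$. Real analytic: a function $f$ on $R$ is real analytic if every $x \in R$ has an open neighbourhood $U$ in $\mathbb{R}^k$ such that on $U \cap R$ the function $f$ is equal to the sum of a power series (its Taylor series) centred at $x$ and convergent on $U$. Set systems. A set system on a set $Y$ is any $\mathcal{C} \subseteq \mathcal{P}(Y)$. For $Y_0 \subseteq Y$, $\mathcal{C}\vert_{Y_0} = \{C \cap Y_0 : C \in \mathcal{C}\}$. $\mathcal{C}$ shatters $Y_0$ if $\mathcal{C}\vert_{Y_0} = \mathcal{P}(Y_0)$. For non-empty $\mathcal{C}$, the VC dimension of $\mathcal{C}$ is $\sup\{|Y_0| : Y_0 \subseteq Y \text{ is shattered by } \mathcal{C}\}$.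 For natural numbers $m, d$ define $\binom{m}{\leq d} = \sum_{i=0}^{d} \binom{m}{i}$ if $m \geq d$, and $\binom{m}{\leq d} = 2^m$ if $m < d$. A set system $\mathcal{C}$ on $Y$ of VC dimension $\alpha$ (finite) is called maximum of VC dimension $\alpha$ if for every finite $Y_0 \subseteq Y$, $|\mathcal{C}\vert_{Y_0}| = \binom{|Y_0|}{\leq \alpha}$. *)

(* Defs.v *)
From HB Require Import structures.
From mathcomp Require Import all_boot all_order all_algebra.
From mathcomp Require Import all_classical all_reals all_analysis.
From mathcomp Require Import measurable_realfun.

Set Implicit Arguments.
Unset Strict Implicit.
Unset Printing Implicit Defensive.

Import Order.TTheory GRing.Theory Num.Theory.
Import numFieldNormedType.Exports.

Local Open Scope classical_set_scope.
Local Open Scope ring_scope.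

Section SetSystems.
Variables (R : realType) (T : choiceType).
Implicit Types (Y : set T) (C : set (set T)).

(* [strace C Y] is {A `&` Y | A in C}. *)
Definition shatters C Y : Prop := strace C Y = [set A | A `<=` Y].

(* [counting Y0] is +oo for infinite Y0; the supremum is -oo only when C is
   empty, since a non-empty system shatters set0. *)
Definition VC_dim Y C : \bar R :=
  ereal_sup [set counting Y0 | Y0 in [set Y0 | Y0 `<=` Y /\ shatters C Y0]].

Definition binomial_le (m d : nat) : nat :=
  if (d <= m)%N then (\sum_(i < d.+1) 'C(m, i))%N else (2 ^ m)%N.

Definition maximum_of_VC_dim Y C (d : nat) : Prop :=
  [/\ forall A, C A -> A `<=` Y,
      VC_dim Y C = d%:R%:E &
      forall (m : nat) (Y0 : set T), Y0 `<=` Y -> (Y0 #= `I_m)%card ->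
        (strace C Y0 #= `I_(binomial_le m d))%card].

End SetSystems.

Arguments VC_dim R {T} Y C.
Arguments maximum_of_VC_dim R {T} Y C d.

Section Functions.
Variables (R : realType) (k : nat).
Implicit Types (D : set 'rV[R]_k) (f : 'rV[R]_k -> R).

Definition unit_cube : set 'rV[R]_k :=
  [set x | forall j, 0 <= x ord0 j <= 1].

(* Functions on D are represented by total functions, of which only the values
   on D matter. *)
Definition linearly_independent_on D n (f : 'I_n -> 'rV[R]_k -> R) : Prop :=
  forall c : 'I_n -> R,
    (forall x, D x -> \sum_(i < n) c i * f i x = 0) -> forall i, c i = 0.

Definition linear_span n (f : 'I_n -> 'rV[R]_k -> R) : set ('rV[R]_k -> R) :=
  [set g | exists c : 'I_n -> R, g = fun x => \sum_(i < n) c i * f i x].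

Definition positivity_sets D f (G : set ('rV[R]_k -> R)) : set (set 'rV[R]_k) :=
  [set [set x | D x /\ f x - g x > 0] | g in G].

Definition power_series_term (c : {ffun 'I_k -> nat} -> R) (x y : 'rV[R]_k)
    (a : {ffun 'I_k -> nat}) : \bar R :=
  (c a * \prod_(j < k) (y ord0 j - x ord0 j) ^+ a j)%:E.

(* Multiple power series have no preferred ordering of their terms, so
   convergence is absolute convergence over all multi-indices; the sum is then
   the difference of the sums of the positive and negative parts. *)
Definition real_analytic_on D f : Prop :=
  forall x, D x ->
  exists (U : set 'rV[R]_k) (c : {ffun 'I_k -> nat} -> R),
    [/\ open U, U x,
        forall y, U y -> summable setT (power_series_term c x y) &
        forall y, U y -> D y ->
          (f y)%:E = (esum setT (power_series_term c x y)^\+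
                      - esum setT (power_series_term c x y)^\-)%E].

End Functions.

Arguments unit_cube : clear implicits.

(* The n-fold product of m with itself on the product sigma-algebra of n-tuples:
   power_measure m n.+1 A is the m-integral over x of
   power_measure m n {t | (x, t) in A}. *)
Section PowerMeasure.
Context d (T : measurableType d) (R : realType).
Variable m : set T -> \bar R.

Fixpoint power_measure (n : nat) : set (n.-tuple T) -> \bar R :=
  match n with
  | 0 => dirac [tuple]
  | n'.+1 => pushforward (m \x @power_measure n')%E
               (fun p : T * n'.-tuple T => [tuple of p.1 :: p.2])
  end.

End PowerMeasure.

Arguments power_measure {d T R} m n.

Lemma power_measure_box d (T : measurableType d) (R : realType)
  (m : {measure set T -> \bar R}) n (A : 'I_n -> set T) :
  (forall i, measurable (A i)) ->
  power_measure m n [set t | forall i, A i (tnth t i)] = (\prod_(i < n) m (A i))%E.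
Proof.
elim: n A => [|n IH] A mA.
  rewrite /= diracE big_ord0 mem_set//=; by case.
rewrite /= /pushforward /product_measure1 big_ord_recl -IH//.
set B := [set t | forall i, A (lift ord0 i) (tnth t i)].
have -> : m (A ord0) = (\int[m]_x (\1_(A ord0) x)%:E)%E by rewrite integral_indic// setIT.
rewrite -ge0_integralZr//.
- apply: eq_integral => x _ /=; rewrite indicE.
  have -> : xsection ((fun p : T * n.-tuple T => [tuple of p.1 :: p.2]) @^-1` [set t | forall i, A i (tnth t i)]) x
    = if x \in A ord0 then B else set0.
    apply/seteqP; split => t; rewrite /xsection /= inE /=.
    + move=> h; move: (h ord0); rewrite tnth0 => /mem_set ->.
      by move=> i; move: (h (lift ord0 i)); rewrite tnthS.
    + case: ifPn => // /set_mem Ax Bt i.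
      by case: (unliftP ord0 i) => [j|] ->; rewrite ?tnthS ?tnth0//; exact: Bt.
  case: ifPn => _; first by rewrite mul1e.
  rewrite mul0e; have : power_measure m n set0 = 0%E.
    clear; elim: n => [|n IH] /=; first by rewrite diracE in_set0.
    rewrite /pushforward /product_measure1 integral0_eq// => x _ /=.
    by rewrite preimage_set0 xsection0.
  by [].
- apply/measurable_EFinP; exact: measurable_indic.
- by rewrite /B (IH (fun i => A (lift ord0 i)))//; apply: prode_ge0.
Qed.

(* R^(k N), as N-tuples of points of R^k; [row_point q i] is the i-th point. *)
Notation sample_space R k N := (N.-tuple (k.-tuple (measurableTypeR R))).

Definition lebesgue_sample (R : realType) (k N : nat) :
    set (sample_space R k N) -> \bar R :=
  power_measure (power_measure (@lebesgue_measure R) k) N.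

Definition row_point (R : realType) (k N : nat) (q : sample_space R k N)
    (i : 'I_N) : 'rV[R]_k :=
  \row_j (tnth (tnth q i) j : R).

Arguments lebesgue_sample : clear implicits.

(* Main.v *)
Require Import Defs.
From mathcomp Require Import all_boot all_order all_algebra.
From mathcomp Require Import all_classical all_reals all_analysis.
From mathcomp Require Import measurable_realfun lra ring.

Set Implicit Arguments.
Unset Strict Implicit.
Unset Printing Implicit Defensive.

Import Order.TTheory GRing.Theory Num.Theory.
Import numFieldNormedType.Exports.

(** For a point x of the cube let F x be the vector (f_0 x, ..., f_n x).  For
    f = c_1 f_1 + ... + c_n f_n the sign of f_0 x - f x is the sign of the inner
    product of F x with (1, -c_1, ..., -c_n), so the traces of C on the sample
    are the sign patterns that the vectors v_i = F (q_i) show to linear forms u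
    with u_0 = 1.  This normalisation is itself an inner product, with the first
    unit vector e_0.  The theorem therefore splits into two statements about the
    N + 1 vectors e_0, v_1, ..., v_N of an (n+1)-dimensional space.

    Almost surely any n + 1 of them are independent ([ae_general_position]).
    A non-trivial linear combination of f_0, ..., f_n is analytic and does not
    vanish identically, so its zeros are negligible; hence F x lies in a given
    proper subspace for a negligible set of points x only, and the points of the
    sample can be added one at a time.  For both uses of Fubini's theorem, in
    the coordinates of one point and in the points of a sample, a null set of a
    power is described by its iterated sections ([pow_null]), starting from the
    finite sets of real numbers.  Since the definition of analyticity allows the
    power series to be centred anywhere in the cube, its restriction to a line
    parallel to an axis is simply the series of the terms along that axis
    ([analytic1_line]), and only analytic functions of one variable remain:
    unless such a function vanishes on all of [0, 1], its zeros there are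
    isolated, hence finite in number ([analytic1_zeros]).  In the same way
    measurability follows from continuity in each coordinate
    ([slicewise_measurable]).

    If any n + 1 of these vectors are independent, then the sign patterns on m
    distinct points number exactly sum_(i <= n) C(m, i) ([card_cells]).  On the
    one hand, n + 1 points are not shattered: writing e_0 as a combination of
    their vectors forbids one sign pattern.  On the other hand, for any n points
    some form vanishes at exactly these n points of the sample, and its small
    perturbations show all 2^n patterns there while nothing changes elsewhere.
    The first fact bounds the number from above by the inequality of Pajor, which
    strengthens the lemma of Sauer and Shelah, and the second one bounds it from
    below by the same inequality for the complementary family of sets
    ([card_of_cubes]). *)

Local Open Scope ring_scope.

(** * Counting sets through the sets they shatter *)

Section FiniteSetSystems.
Import mathcomp.boot.fintype mathcomp.boot.finset.

Definition fshatters {T : finType} (F : {set {set T}}) (S : {set T}) : bool :=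
  [forall A : {set T}, (A \subset S) ==> [exists B in F, B :&: S == A]].

Lemma fshattersP (T : finType) (F : {set {set T}}) (S : {set T}) :
  reflect (forall A : {set T}, A \subset S -> exists2 B, B \in F & B :&: S = A)
          (fshatters F S).
Proof.
apply: (iffP forallP) => [h A AS|h A].
  by have /implyP/(_ AS)/existsP[B /andP[BF /eqP]] := h A; exists B.
apply/implyP => /h[B BF BSA]; apply/existsP; exists B.
by rewrite BF BSA eqxx.
Qed.

Lemma fshattersS (T : finType) (F G : {set {set T}}) (S : {set T}) :
  F \subset G -> fshatters F S -> fshatters G S.
Proof.
move=> /subsetP FG /fshattersP h; apply/fshattersP => A /h[B BF <-].
by exists B => //; exact: FG.
Qed.

(** Pajor's inequality.  Split F by an element x on which two members disagree.
    A set shattered by either half avoids x, and a set S shattered by both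
    halves yields the further shattered set S + x, so the numbers of sets
    shattered by the halves add up. *)
Lemma card_le_shattered (T : finType) (F : {set {set T}}) :
  (#|F| <= #|[set S | fshatters F S]|)%N.
Proof.
have [c] := ubnP #|F|; elim: c F => // c IH F /ltnSE Fc.
have [|cF] := leqP #|F| 1.
  case: (set_0Vmem F) => [-> _|[A AF] cF]; first by rewrite cards0.
  apply: (leq_trans cF); apply/card_gt0P; exists set0.
  rewrite inE; apply/fshattersP => B; rewrite subset0 => /eqP ->.
  by exists A => //; rewrite setI0.
have [A [B [AF BF AB]]] : exists A B, [/\ A \in F, B \in F & A != B].
  have /card_gt0P[A AF] : (0 < #|F|)%N by exact: ltn_trans cF.
  have /card_gt0P[B] : (0 < #|F :\ A|)%N.
    by move: cF; rewrite (cardsD1 A) AF.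
  rewrite in_setD1 => /andP[BA BF]; exists A, B; split => //.
  by rewrite eq_sym.
have [x xAB] : exists x, (x \in A) != (x \in B).
  apply/existsP; rewrite -negb_forall; apply: contra AB => /forallP h.
  by apply/eqP/setP => x; apply/eqP.
(* F0 and F1 are the two halves of F. *)
pose F0 := [set C in F | x \notin C]; pose F1 := [set C in F | x \in C].
have FE : #|F| = (#|F1| + #|F0|)%N.
  rewrite -(cardsID [set C : {set T} | x \in C] F).
  by congr (_ + _)%N; apply: eq_card => C; rewrite !inE// andbC.
have F0_gt0 : (0 < #|F0|)%N.
  apply/card_gt0P; case xA: (x \in A); last by exists A; rewrite inE AF xA.
  by exists B; rewrite inE BF; move: xAB; rewrite xA; case: (x \in B).
have F1_gt0 : (0 < #|F1|)%N.
  apply/card_gt0P; case xA: (x \in A); first by exists A; rewrite inE AF xA.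
  by exists B; rewrite inE BF; move: xAB; rewrite xA; case: (x \in B).
have {}IH0 : (#|F0| <= #|[set S | fshatters F0 S]|)%N.
  by apply: IH; apply: leq_trans Fc; rewrite FE -[X in (X < _)%N]add0n ltn_add2r.
have {}IH1 : (#|F1| <= #|[set S | fshatters F1 S]|)%N.
  by apply: IH; apply: leq_trans Fc; rewrite FE -[X in (X < _)%N]addn0 ltn_add2l.
set sh0 := [set S | fshatters F0 S] in IH0.
set sh1 := [set S | fshatters F1 S] in IH1.
have x0 S : S \in sh0 -> x \notin S.
  rewrite inE => /fshattersP h; apply/negP => xS.
  have [|C] := h [set x]; first by rewrite sub1set.
  rewrite inE => /andP[_ /negP xC] /setP/(_ x); rewrite !inE eqxx.
  by case/andP.
have x1 S : S \in sh1 -> x \notin S.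
  rewrite inE => /fshattersP h; apply/negP => xS.
  have [|C] := h set0; first by rewrite sub0set.
  by rewrite inE => /andP[_ xC] /setP/(_ x); rewrite !inE xC xS.
pose U := [set x |: S | S in sh0 :&: sh1].
have cU : #|U| = #|sh0 :&: sh1|.
  rewrite card_in_imset// => S S'; rewrite !inE => /andP[S0 _] /andP[S0' _] SS'.
  have xS : x \notin S by apply: x0; rewrite inE.
  have xS' : x \notin S' by apply: x0; rewrite inE.
  by rewrite -(setU1K xS) SS' setU1K.
have dU : [disjoint sh0 :|: sh1 & U].
  rewrite disjoint_subset; apply/subsetP => S Ssh; rewrite inE.
  apply/imsetP => -[S' _ SS']; move: Ssh; rewrite inE.
  by case/orP => [/x0|/x1]; rewrite SS' setU11.
rewrite FE.
(* U collects the sets S + x, disjoint from the sets shattered by the halves. *)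
apply: (leq_trans (leq_add IH1 IH0)).
rewrite addnC -cardsUI -cU -(cardsUI _ U).
move: dU; rewrite -setI_eq0 => /eqP ->; rewrite cards0 addn0.
apply: subset_leq_card; apply/subsetP => S /setUP[/setUP[]|/imsetP[S' /setIP[S0 S1] ->]].
- by rewrite !inE; apply: fshattersS; apply/subsetP => C; rewrite inE => /andP[].
- by rewrite !inE; apply: fshattersS; apply/subsetP => C; rewrite inE => /andP[].
have xS' := x0 _ S0; move: S0 S1; rewrite !inE => /fshattersP S0 /fshattersP S1.
apply/fshattersP => D DS; have DS' : D :\ x \subset S' by rewrite subDset.
case xD: (x \in D).
  have [C] := S1 _ DS'; rewrite inE => /andP[CF xC] CS'; exists C => //.
  rewrite setIUr CS' (_ : C :&: [set x] = [set x]) ?setD1K//.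
  by apply/setIidPr; rewrite sub1set.
have [C] := S0 _ DS'; rewrite inE => /andP[CF xC] CS'; exists C => //.
rewrite setIUr CS' (_ : C :&: [set x] = set0); last first.
  by apply/eqP; rewrite setI_eq0 disjoint_sym disjoints1.
by rewrite set0U; apply/setDidPl; rewrite disjoint_sym disjoints1 xD.
Qed.

Lemma card_sets_le (T : finType) n :
  #|[set S : {set T} | (#|S| <= n)%N]| = (\sum_(i < n.+1) 'C(#|T|, i))%N.
Proof.
rewrite -sum1_card (partition_big (fun S : {set T} => inord #|S| : 'I_n.+1) predT)//=.
apply: eq_bigr => i _; rewrite -card_draws -sum1_card; apply: eq_bigl => S.
rewrite !inE; apply/andP/eqP => [[Sn /eqP <-]|Si]; first by rewrite inordK.
have Sn : (#|S| < n.+1)%N by rewrite Si.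
by split => //; apply/eqP/val_inj; rewrite /= inordK.
Qed.

(** The second hypothesis says that F contains a cube in the directions of every
    small S.  Then the complement of F cannot shatter the complement of S: the
    pattern of B there would have to be completed outside F, but all its
    completions lie in the cube.  So the lower bound on F is Pajor's upper bound
    for its complement. *)
Lemma card_of_cubes (T : finType) (F : {set {set T}}) n :
  (forall S, fshatters F S -> (#|S| <= n)%N) ->
  (forall S : {set T}, (#|S| <= n)%N ->
     exists B : {set T}, forall A : {set T}, A \subset S -> A :|: (B :\: S) \in F) ->
  #|F| = (\sum_(i < n.+1) 'C(#|T|, i))%N.
Proof.
move=> ub lb; rewrite -card_sets_le; apply/eqP; rewrite eqn_leq; apply/andP; split.
  apply: leq_trans (card_le_shattered F) _; apply: subset_leq_card; apply/subsetP => S.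
  by rewrite !inE; exact: ub.
suff h : (#|~: F| <= #|~: [set S : {set T} | (#|S| <= n)%N]|)%N.
  rewrite -(leq_add2r #|~: F|) cardsC.
  by rewrite -(cardsC [set S : {set T} | (#|S| <= n)%N]) leq_add2l.
apply: leq_trans (card_le_shattered _) _.
rewrite -(card_imset (mem [set S : {set T} | fshatters (~: F) S]) (can_inj (@setCK T))).
apply: subset_leq_card; apply/subsetP => S /imsetP[S' + ->].
rewrite !inE => /fshattersP sh; apply/negP => /lb[B hB].
have [|C] := sh (B :&: S'); first exact: subsetIr.
rewrite inE => /negP CF CB; apply: CF.
rewrite (_ : C = (C :\: S') :|: (B :\: ~: S')).
  by apply: hB; rewrite setDE subsetIr.
by rewrite [B :\: _]setDE setCK -CB setUC setID.
Qed.

Lemma exists_perturbation (R : realFieldType) (I : finType) (a b : I -> R) :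
  (forall i, a i != 0) ->
  exists2 e : R, 0 < e & forall i, (0 < a i + e * b i) = (0 < a i).
Proof.
move=> a0; pose e := \big[Num.min/1]_i (`|a i| / (1 + `|b i|)).
have b1 i : 0 < 1 + `|b i| by rewrite ltr_pwDl.
have e0 : 0 < e.
  rewrite /e; elim/big_ind: _ => // [x y x0 y0|j _]; first by rewrite lt_min x0.
  by rewrite divr_gt0// normr_gt0.
exists e => // i.
have ei : e * (1 + `|b i|) <= `|a i|.
  by rewrite -ler_pdivlMr// /e (bigD1 i)//= ge_min lexx.
have : `|e * b i| < `|a i|.
  by rewrite normrM gtr0_norm//; apply: lt_le_trans ei; rewrite ltr_pM2l// ltrDr.
rewrite ltr_norml; have [ai|ai|/eqP] := ltrgt0P (a i); last by rewrite (negbTE (a0 i)).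
  by move=> /andP[h1 h2]; rewrite ?ai; lra.
by move=> /andP[h1 h2]; apply/negbTE; rewrite -leNgt; lra.
Qed.

(** * Sign patterns of vectors in general position *)

Definition general_position (F : fieldType) (I : Type) n (v : I -> 'rV[F]_n) :=
  forall s : 'I_n -> I, injective s -> \matrix_i v (s i) \in unitmx.

Lemma mulmx_rowsE (F : fieldType) (I : Type) p n (v : I -> 'rV[F]_n)
    (s : 'I_p -> I) (u : 'cV_n) i :
  ((\matrix_i v (s i)) *m u) i 0 = (v (s i) *m u) 0 0.
Proof.
transitivity (row i (\matrix_i v (s i) *m u) 0 0); first by rewrite [RHS]mxE.
by rewrite row_mul rowK.
Qed.

Section Arrangement.
Variables (R : realFieldType) (n N : nat) (v : option 'I_N -> 'rV[R]_n.+1).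
Variables (T : finType) (g : T -> 'I_N).
Hypothesis v_gen : general_position v.
Hypothesis g_inj : injective g.

(** The cell of the hyperplane arrangement that contains u, described by the
    members of the arrangement on whose positive side u lies.  The vector
    [v None] normalises u. *)
Definition cell (u : 'cV[R]_n.+1) : {set T} :=
  [set x | 0 < (v (Some (g x)) *m u) 0 0].

Definition cells : {set {set T}} :=
  [set S | `[< exists2 u, (v None *m u) 0 0 = 1 & S = cell u >]].

(** The normalising vector is a combination of any n + 1 of the other vectors,
    and on each cell this combination takes the value 1.  The pattern that is
    positive exactly where the coefficients are not would make it at most 0. *)
Lemma cells_shatter_le S : fshatters cells S -> (#|S| <= n)%N.
Proof.
move=> /fshattersP sh; rewrite leqNgt; apply/negP => Sn.
pose x j : T := enum_val (widen_ord Sn j).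
have x_inj : injective x by move=> j j' /enum_val_inj[] /val_inj.
pose M := \matrix_j v (Some (g (x j))).
have Mu : M \in unitmx by apply: v_gen => j j' [] /g_inj/x_inj.
pose l := v None *m invmx M.
pose A := [set x j | j in [set j | l 0 j <= 0]].
have [|B] := sh A; first by apply/subsetP => _ /imsetP[j _ ->]; exact: enum_valP.
rewrite inE => /asboolP[u u1 ->] AE.
(* The row l holds the coefficients of the normalising vector. *)
have : (l *m (M *m u)) 0 0 = 1 by rewrite /l mulmxA mulmxKV.
rewrite mxE => sum1.
suff : \sum_j l 0 j * (M *m u) j 0 <= 0 by rewrite sum1 ler10.
apply: sumr_le0 => j _; rewrite mulmx_rowsE.
have : (x j \in cell u) = (l 0 j <= 0).
  have := congr1 (fun X : {set T} => x j \in X) AE.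
  rewrite in_setI enum_valP andbT => ->.
  by rewrite (mem_imset _ _ x_inj) inE.
rewrite inE; case: (leP (l 0 j)) => l0 h; first by rewrite mulr_le0_ge0// ltW.
by rewrite pmulr_rle0// leNgt h.
Qed.

(** Enlarge S to n indices J and take the normalised u0 that vanishes on J.
    General position forbids u0 to vanish anywhere else, so small perturbations
    of u0 change the signs on J only, and they realise all patterns there. *)
Lemma cells_cube (S : {set T}) : (n <= N)%N -> (#|S| <= n)%N ->
  exists B : {set T}, forall A : {set T}, A \subset S -> A :|: (B :\: S) \in cells.
Proof.
move=> nN Sn.
have [J SJ Jn] : exists2 J : {set 'I_N}, g @: S \subset J & #|J| = n.
  have : (#|g @: S| <= n)%N by rewrite card_imset.
  move: (g @: S) => K.
  elim: {1}(n - #|K|)%N {-2}K (erefl (n - #|K|)%N) => [|c IH] {}K Kc Kn.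
    by exists K => //; apply/eqP; rewrite eqn_leq Kn -subn_eq0 Kc.
  have /card_gt0P[z] : (0 < #|~: K|)%N.
    by rewrite cardsCs setCK card_ord subn_gt0 (leq_trans _ nN)// -subn_gt0 Kc.
  rewrite inE => zK.
  have [||J KJ Jn] := IH (z |: K).
  - by rewrite cardsU1 zK add1n subnS Kc.
  - by rewrite cardsU1 zK -subn_gt0 Kc.
  by exists J => //; apply: subset_trans KJ; exact: subsetUr.
pose y (j : 'I_n) : 'I_N := enum_val (cast_ord (esym Jn) j).
have yJ j : y j \in J by exact: enum_valP.
have y_inj : injective y by move=> j j' /enum_val_inj/cast_ord_inj.
have yS z : z \in J -> exists j, y j = z.
  move=> zJ; exists (cast_ord Jn (enum_rank_in zJ z)).
  by rewrite /y cast_ordK enum_rankK_in.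
(* The n indices of J, preceded by one further index z. *)
pose s z (i : 'I_n.+1) : option 'I_N :=
  if unlift ord0 i is Some j then Some (y j) else z.
have s_inj z : (forall j, z != Some (y j)) -> injective (s z).
  move=> zy i i'; rewrite /s.
  case: unliftP => [j ->|->]; case: unliftP => [j' ->|->] //.
  - by move=> [] /y_inj ->.
  - by move=> /esym/eqP; rewrite (negbTE (zy _)).
  - by move=> /eqP; rewrite (negbTE (zy _)).
pose M z := \matrix_i v (s z i).
have Mu z : (forall j, z != Some (y j)) -> M z \in unitmx.
  by move=> /s_inj; exact: v_gen.
have MNone : M None \in unitmx by exact: Mu.
have sol (b : 'I_n.+1 -> R) i :
    (v (s None i) *m (invmx (M None) *m \col_i b i)) 0 0 = b i.
  by rewrite -mulmx_rowsE mulKVmx// mxE.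
pose sol_for b := invmx (M None) *m \col_i b i.
have solN b : (v None *m sol_for b) 0 0 = b ord0.
  by have := sol b ord0; rewrite /s unlift_none.
have solJ b j : (v (Some (y j)) *m sol_for b) 0 0 = b (lift ord0 j).
  by have := sol b (lift ord0 j); rewrite /s liftK.
pose u0 := sol_for (fun i => (i == 0)%:R).
(* The direction d A is positive at A and negative at the rest of J, and it keeps the
   normalisation. *)
pose d (A : {set T}) : 'cV[R]_n.+1 := sol_for (fun i =>
  if unlift ord0 i is Some j then (if y j \in g @: A then 1 else -1) else 0).
have u0N : (v None *m u0) 0 0 = 1 by rewrite solN.
have u0J z : z \in J -> (v (Some z) *m u0) 0 0 = 0.
  by move=> /yS[j <-]; rewrite solJ.
have u0NJ z : z \notin J -> (v (Some z) *m u0) 0 0 != 0.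
  move=> zJ; apply/eqP => u0z.
  have Mz : M (Some z) \in unitmx.
    by apply: Mu => j; apply: contra zJ => /eqP[->].
  have : M (Some z) *m u0 = 0.
    apply/matrixP => i j; rewrite ord1 mulmx_rowsE [RHS]mxE /s.
    by case: unliftP => [k _|//]; exact: u0J.
  move=> /(congr1 (mulmx (invmx (M (Some z))))); rewrite mulKmx// mulmx0 => u00.
  by move: u0N; rewrite u00 mulmx0 mxE => /esym/eqP; rewrite oner_eq0.
have dN A : (v None *m d A) 0 0 = 0 by rewrite solN unlift_none.
have dJ A z : z \in J -> (v (Some z) *m d A) 0 0 = if z \in g @: A then 1 else -1.
  by move=> /yS[j <-]; rewrite solJ liftK.
pose a (k : {z | z \notin J} * {set T}) := (v (Some (val k.1)) *m u0) 0 0.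
pose b (k : {z | z \notin J} * {set T}) := (v (Some (val k.1)) *m d k.2) 0 0.
have [|e e0 he] := @exists_perturbation R _ a b; first by move=> [[z zJ] A]; exact: u0NJ.
have lin z A : (v z *m (u0 + e *: d A)) 0 0 = (v z *m u0) 0 0 + e * (v z *m d A) 0 0.
  by rewrite mulmxDr -scalemxAr mxE; congr (_ + _); rewrite mxE.
exists (cell u0) => A AS; rewrite inE; apply/asboolP; exists (u0 + e *: d A).
  by rewrite lin u0N dN mulr0 addr0.
apply/setP => x; rewrite !inE lin.
case: (boolP (g x \in J)) => gxJ.
  rewrite u0J// ltxx andbF orbF add0r dJ// pmulr_rgt0// (mem_imset _ _ g_inj).
  by case: ifP => _; rewrite ?ltr01// oppr_gt0 ltr10.
have -> : x \in S = false.
  by apply: contraNF gxJ => xS; apply: (subsetP SJ); exact: imset_f.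
have -> : x \in A = false.
  apply: contraNF gxJ => xA; apply: (subsetP SJ); apply: imset_f.
  exact: (subsetP AS).
by have := he (exist _ (g x) gxJ, A); rewrite /a /b /= => ->.
Qed.

Lemma card_cells : (n <= N)%N -> #|cells| = (\sum_(i < n.+1) 'C(#|T|, i))%N.
Proof.
move=> nN; apply: card_of_cubes; first exact: cells_shatter_le.
by move=> S; exact: cells_cube.
Qed.

End Arrangement.

End FiniteSetSystems.

Local Open Scope classical_set_scope.

(** * From sign patterns to maximum set systems *)

Lemma card_finset (K : finType) (A : {set K}) : ([set` A] #= `I_#|A|)%card.
Proof.
have -> : [set` A] = enum_val @` [set: 'I_#|A|].
  apply/seteqP; split => x /=; last by case=> i _ <-; exact: enum_valP.
  by move=> xA; exists (enum_rank_in xA x) => //; rewrite enum_rankK_in.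
apply: (card_eq_trans (inj_card_eq _)); last by rewrite card_eq_sym card_II.
by move=> i j _ _; exact: enum_val_inj.
Qed.

Lemma binomial_leE m d : binomial_le m d = (\sum_(i < d.+1) 'C(m, i))%N.
Proof.
rewrite /binomial_le; case: leqP => // md.
rewrite -[in RHS](card_ord m) -card_sets_le -[in LHS](card_ord m) -cardsT -card_powerset.
apply: eq_card => S; rewrite !inE finset.subsetT; apply/esym.
by apply: leq_trans (ltnW md); rewrite -[X in (_ <= X)%N](card_ord m); exact: max_card.
Qed.

Lemma unitmx_rows_inj (F : fieldType) n (A : 'M[F]_n) :
  A \in unitmx -> injective (fun i => row i A).
Proof.
rewrite unitmxE unitfE => detA i j ij; apply: contraNeq detA => nij.
apply/eqP/(determinant_alternate nij) => k.
by have := congr1 (fun M : 'rV_n => M ord0 k) ij; rewrite !mxE.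
Qed.

Section Maximum.
Variables (R : realType) (X : choiceType) (n N : nat).
Variables (p : 'I_N -> X) (v : option 'I_N -> 'rV[R]_n.+1) (C : set (set X)).
Hypothesis ltnN : (n < N)%N.
Hypothesis v_gen : general_position v.
Hypothesis v_p : forall i j, p i = p j -> v (Some i) = v (Some j).
Hypothesis C_cell : forall A, C A -> exists2 u : 'cV_n.+1, (v None *m u) 0 0 = 1 &
  forall i, A (p i) <-> 0 < (v (Some i) *m u) 0 0.
Hypothesis cell_C : forall u : 'cV_n.+1, (v None *m u) 0 0 = 1 ->
  exists2 A, C A & forall i, A (p i) <-> 0 < (v (Some i) *m u) 0 0.

Section Subset.
Variables (m : nat) (g : 'I_m -> 'I_N).
Hypothesis pg_inj : injective (p \o g).
Let Y := range (p \o g).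
Let lift_set (S : {set 'I_m}) : set X := (p \o g) @` [set` S].

Let g_inj : injective g.
Proof. by move=> i j ij; apply: pg_inj; rewrite /= ij. Qed.

Let lift_setE S i : lift_set S (p (g i)) <-> i \in S.
Proof.
split=> [[j jS /pg_inj <-//]|iS]; by exists i.
Qed.

Let lift_set_inj : injective lift_set.
Proof.
move=> S S' SS'; apply/setP => i; apply/idP/idP => /lift_setE.
  by rewrite SS' => /lift_setE.
by rewrite -SS' => /lift_setE.
Qed.

Let lift_cell A (u : 'cV_n.+1) : (forall i, A (p i) <-> 0 < (v (Some i) *m u) 0 0) ->
  A `&` Y = lift_set (cell v g u).
Proof.
move=> Au; apply/seteqP; split => x /=.
  by move=> [+ [i _ ix]]; rewrite -ix /= => /Au xu; apply/lift_setE; rewrite inE.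
by move=> [i + <-]; rewrite /= inE => iu; split; [exact/Au|exists i].
Qed.

(** Traces on the points p (g i) are cells of the arrangement of their vectors;
    the injectivity of p \o g makes this correspondence one-to-one. *)
Lemma strace_cells : strace (strace C (range p)) Y = lift_set @` [set` cells v g].
Proof.
have Yp : Y `<=` range p by move=> _ [i _ <-]; exists (g i).
apply/seteqP; split => [_ [_ [A CA <-] <-]|_ [S + <-]].
  have [u u1 Au] := C_cell CA; exists (cell v g u).
    by rewrite /= inE; apply/asboolP; exists u.
  by rewrite -setIA (setIidr Yp) (lift_cell Au).
rewrite /= inE => /asboolP[u u1 ->]; have [A CA Au] := cell_C u1.
exists (A `&` range p); first by exists A.
by rewrite -setIA (setIidr Yp) (lift_cell Au).
Qed.

Lemma card_strace : (strace (strace C (range p)) Y #= `I_(binomial_le m n))%card.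
Proof.
rewrite strace_cells; apply: (card_eq_trans (inj_card_eq _)).
  by move=> S S' _ _; exact: lift_set_inj.
rewrite binomial_leE -[in X in `I_X](card_ord m) -(card_cells v_gen g_inj (ltnW ltnN)).
exact: card_finset.
Qed.

Lemma shatters_size_le : shatters (strace C (range p)) Y <-> (m <= n)%N.
Proof.
rewrite /shatters strace_cells; split => [h|mn].
  rewrite -(card_ord m) -cardsT; apply: (cells_shatter_le v_gen g_inj).
  apply/fshattersP => A _; exists A; last by rewrite finset.setIT.
  have : [set A | A `<=` Y] (lift_set A) by move=> _ [i _ <-]; exists i.
  by rewrite -h => -[S SA /lift_set_inj <-].
have cellsT S : S \in cells v g.
  have [|B /(_ S)] := @cells_cube _ _ _ v 'I_m g v_gen g_inj [set: 'I_m]%SET (ltnW ltnN).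
    by rewrite cardsT card_ord.
  by rewrite finset.subsetT finset.setDT finset.setU0 => /(_ isT).
apply/seteqP; split => [_ [S _ <-] _ [i _ <-]|A AY]; first by exists i.
exists [set i | `[<A (p (g i))>]]%SET; first exact: cellsT.
apply/seteqP; split => x /=; first by move=> [i /= + <-]; rewrite inE => /asboolP.
move=> Ax; have [i _ ix] := AY _ Ax; exists i => //=; rewrite inE; apply/asboolP.
by move: Ax; rewrite -ix.
Qed.

End Subset.

(** Sample points may coincide, so a set of m points is handled through a choice
    of m indices representing it. *)
Lemma range_sub_param (Y : set X) m : Y `<=` range p -> (Y #= `I_m)%card ->
  exists2 g : 'I_m -> 'I_N, injective (p \o g) & Y = range (p \o g).
Proof.
move=> Yp Ym.
have /card_bijP[f [f' fK f'K]] : ([set: 'I_m] #= Y)%card.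
  by rewrite card_eq_sym (card_eq_trans Ym)// card_II.
pose h (i : 'I_m) : X := val (f (SigSub (mem_set (I : [set: 'I_m] i)))).
have h_inj : injective h.
  by move=> i j /val_inj/(can_inj fK)/(congr1 val).
have hY i : Y (h i) by exact: set_valP.
have Yh y : Y y -> exists i, h i = y.
  move=> Yy; exists (val (f' (SigSub (mem_set Yy)))).
  rewrite /h (_ : SigSub _ = f' (SigSub (mem_set Yy))) ?f'K//.
  exact: val_inj.
have [g hg] : {g : 'I_m -> 'I_N & forall i, p (g i) = h i}.
  apply: (@choice _ _ (fun i j => p j = h i)) => i.
  by have [j _ pj] := Yp _ (hY i); exists j.
exists g; first by move=> i j; rewrite /= !hg => /h_inj.
apply/seteqP; split => [y /Yh[i <-]|_ [i _ <-]]; first by exists i => //=.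
by rewrite /= hg.
Qed.

(** That there are n distinct points is a consequence of general position as
    well: n + 1 indices with independent vectors have distinct points. *)
Lemma maximum_range : maximum_of_VC_dim R (range p) (strace C (range p)) n.
Proof.
have fin_p : finite_set (range p) by apply: finite_image; exact: finite_finset.
split.
- by move=> _ [A _ <-]; exact: subIsetr.
- apply/eqP; rewrite eq_le; apply/andP; split.
    apply: ge_ereal_sup => _ [Y [Yp shY] <-].
    have finY : finite_set Y by exact: sub_finite_set fin_p.
    have /finite_setP[m Ym] := finY.
    have [g pg YE] := range_sub_param Yp Ym.
    rewrite /counting asboolT// (card_fset_set Ym) lee_fin ler_nat.
    by move: shY; rewrite YE => /shatters_size_le -> .
  apply: ereal_sup_ubound.
  (* The first n + 1 sample points are distinct; the first n of them are shattered. *)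
  pose s (j : 'I_n.+1) := widen_ord ltnN j.
  have ps : injective (p \o s).
    have : \matrix_j v (Some (s j)) \in unitmx.
      by apply: v_gen => i j [] /val_inj.
    move=> /unitmx_rows_inj inj i j ij; apply: inj; rewrite !rowK.
    exact: v_p.
  have pg : injective (p \o (s \o widen_ord (leqnSn n))).
    by move=> i j /ps [] /val_inj.
  exists (range (p \o (s \o widen_ord (leqnSn n)))).
    split; first by move=> _ [i _ <-]; eexists.
    exact/(shatters_size_le pg).
  have YE : (range (p \o (s \o widen_ord (leqnSn n))) #= `I_n)%card.
    apply: (card_eq_trans (inj_card_eq _)); last by rewrite card_eq_sym card_II.
    by move=> i j _ _; exact: pg.
  rewrite /counting asboolT; last by apply/finite_setP; exists n.
  by rewrite (card_fset_set YE).
- move=> m Y Yp Ym; have [g pg ->] := range_sub_param Yp Ym.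
  exact: card_strace.
Qed.

End Maximum.

(** * Null sets of power measures through iterated sections *)

(** The n-th power of a notion I of null set, in the manner of Fubini's theorem:
    except for a null set of first components, the section is null in the
    remaining ones.  Being defined by sections alone it applies to arbitrary
    sets, and induction on n takes the place of an exchange of the order of
    integration. *)
Fixpoint pow_null (T : Type) (I : set (set T)) (n : nat) : set (set (n.-tuple T)) :=
  match n with
  | 0 => [set set0]
  | n'.+1 => [set A : set (n'.+1.-tuple T) |
      I [set x | ~ @pow_null T I n' [set t : n'.-tuple T | A [tuple of x :: t]]]]
  end.
Arguments pow_null {T} I n A.

Section PowNull.
Variables (T : Type) (I : set (set T)).
Hypothesis I0 : I set0.
Hypothesis I_sub : forall A B, A `<=` B -> I B -> I A.

Lemma pow_null0 n : pow_null I n set0.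
Proof.
elim: n => [//|n IH] /=.
by apply: I_sub I0 => x; apply.
Qed.

Lemma pow_null_sub n (A B : set (n.-tuple T)) :
  A `<=` B -> pow_null I n B -> pow_null I n A.
Proof.
elim: n A B => [|n IH] A B AB /=.
  by move=> B0; rewrite B0 in AB; apply/seteqP; split.
apply: I_sub => x; apply: contra_not; apply: IH => t; exact: AB.
Qed.

End PowNull.

Section PowerMeasureNull.
Context d (T : measurableType d) (R : realType).
Variable m : set T -> \bar R.
Local Open Scope ereal_scope.

Import HBNNSimple.

(** Every simple function below the positive or the negative part of f has its
    nonzero level sets inside N, so the suprema defining the integral are 0.  The
    argument works for any set function m, such as a power measure, about which
    no additivity has been established. *)
Lemma integral_null (f : T -> \bar R) (N : set T) :
  (forall A, A `<=` N -> m A = 0) -> (forall x, ~ N x -> f x = 0) -> \int[m]_x f x = 0.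
Proof.
move=> mN fN.
have sup0 (g : T -> \bar R) : (forall x, 0 <= g x) -> (forall x, ~ N x -> g x = 0) ->
    ereal_sup [set sintegral m h |
      h in [set h : {nnsfun T >-> R} | forall x, (h x)%:E <= g x]] = 0.
  move=> g0 gN; apply/eqP; rewrite eq_le; apply/andP; split.
    apply: ge_ereal_sup => _ [h hg <-].
    rewrite /sintegral fsbig1// => r _.
    have [->|r0] := eqVneq r 0%R; first by rewrite mul0e.
    rewrite mN ?mule0// => x /= hxr; apply: contrapT => /gN gx0.
    have := hg x; rewrite gx0 hxr lee_fin => r_le0.
    have : (0 <= h x)%R by exact: fun_ge0.
    by rewrite hxr => r_ge0; move: r0; rewrite eq_le r_le0 r_ge0.
  apply: ereal_sup_ubound; exists nnsfun0 => //=.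
  rewrite /sintegral fsbig1// => r _.
  have [->|r0] := eqVneq r 0%R; first by rewrite mul0e.
  rewrite (_ : _ @^-1` _ = set0) ?mN ?mule0//.
  by rewrite -subset0 => x /= xr; move: r0; rewrite -xr eqxx.
rewrite /integral patch_setT !sup0 ?sube0// => x Nx.
  by rewrite funenegE fN// oppe0 maxxx.
by rewrite funeposE fN// maxxx.
Qed.

End PowerMeasureNull.

(** The power measure is an iterated integral, first component outermost, and the
    sections that are not null occur only over an m-null set of first
    components. *)
Lemma power_measure_null d (T : measurableType d) (R : realType)
    (m : set T -> \bar R) (I : set (set T)) n (A : set (n.-tuple T)) :
  (forall A B, A `<=` B -> I B -> I A) -> (forall A, I A -> m A = 0%E) ->
  pow_null I n A -> power_measure m n A = 0%E.
Proof.
move=> I_sub mI; elim: n A => [|n IH] A.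
  by move=> /= ->; rewrite diracE in_set0.
rewrite /= /pushforward /product_measure1 => nA.
apply: (integral_null (N :=
  [set x | ~ pow_null I n [set t : n.-tuple T | A [tuple of x :: t]]])).
  by move=> B /I_sub/(_ nA)/mI.
move=> x /contrapT nAx; rewrite /= IH//.
rewrite (_ : xsection _ _ = [set t : n.-tuple T | A [tuple of x :: t]])//.
by apply/seteqP; split => t; rewrite /xsection /= inE.
Qed.

(** * Analytic functions on the unit interval *)

Section Analytic1.
Variable R : realType.
Implicit Types (g h : R -> R) (t : R).

(** Analyticity on [0, 1], with the data that the estimates use: a radius r up to
    which the series represents g on [0, 1], and a bound on the absolute series
    at that radius. *)
Definition analytic1 g := forall t0, 0 <= t0 <= 1 ->
  exists (r : R) (c : nat -> R) (S : R),
  [/\ 0 < r, forall n, \sum_(0 <= i < n) `|c i| * r ^+ i <= S &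
      forall t, 0 <= t <= 1 -> `|t - t0| <= r ->
        series (fun i => c i * (t - t0) ^+ i) @ \oo --> g t].

Lemma analytic10 : analytic1 (fun=> 0).
Proof.
move=> t0 _; exists 1, (fun=> 0), 0; split => // [n|t _ _].
  by rewrite big1// => i _; rewrite normr0 mul0r.
rewrite (_ : series _ = cst 0); first exact: cvg_cst.
by apply/funext => n; rewrite /series /= big1// => i _; rewrite mul0r.
Qed.

Lemma analytic1_lin a g h : analytic1 g -> analytic1 h ->
  analytic1 (fun t => a * g t + h t).
Proof.
move=> ag ah t0 t01.
have [r [c [S [r0 cS cg]]]] := ag _ t01.
have [r' [c' [S' [r'0 cS' cg']]]] := ah _ t01.
pose q := Num.min r r'.
have q0 : 0 < q by rewrite lt_min r0.
have qr : q <= r by rewrite ge_min lexx.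
have qr' : q <= r' by rewrite ge_min lexx orbT.
have qX x i : q <= x -> q ^+ i <= x ^+ i.
  move=> qx; have x0 := le_trans (ltW q0) qx.
  by apply: lerXn2r; rewrite ?nnegrE// ltW.
exists q, (fun i => a * c i + c' i), (`|a| * S + S'); split => // [n|t tI tq].
  apply: (@le_trans _ _ (`|a| * (\sum_(0 <= i < n) `|c i| * r ^+ i) +
      \sum_(0 <= i < n) `|c' i| * r' ^+ i)).
    rewrite mulr_sumr -big_split/=; apply: ler_sum => i _.
    apply: (@le_trans _ _ ((`|a| * `|c i| + `|c' i|) * q ^+ i)).
      apply: ler_wpM2r; first by rewrite exprn_ge0// ltW.
      by rewrite (le_trans (ler_normD _ _))// normrM.
    rewrite mulrDl -mulrA; apply: lerD.
      by apply: ler_wpM2l => //; apply: ler_wpM2l => //; exact: qX.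
    by apply: ler_wpM2l => //; exact: qX.
  by rewrite lerD// ler_wpM2l.
rewrite (_ : series _ = (fun n => a * series (fun i => c i * (t - t0) ^+ i) n +
   series (fun i => c' i * (t - t0) ^+ i) n)).
  apply: cvgD; last by apply: cg' => //; exact: le_trans qr'.
  by apply: cvgMr; apply: cg => //; exact: le_trans qr.
apply/funext => n; rewrite /series /= mulr_sumr -big_split/=.
by apply: eq_bigr => i _; ring.
Qed.

Lemma analytic1_sum (I : finType) (a : I -> R) (g : I -> R -> R) :
  (forall i, analytic1 (g i)) -> analytic1 (fun t => \sum_i a i * g i t).
Proof.
move=> ag; rewrite (_ : (fun t => _) = \sum_i (fun t => a i * g i t)); last first.
  by apply/funext => t; rewrite fct_sumE.
elim/big_rec: _ => [|i x _ ax]; first exact: analytic10.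
exact: analytic1_lin.
Qed.

(** A tail of index N carries a factor s^N, and (s / r)^N can be taken out of it,
    leaving a part of the absolutely bounded series at r. *)
Lemma series_tail (c : nat -> R) (r S : R) (s l : R) N :
  0 < r -> (forall n, \sum_(0 <= i < n) `|c i| * r ^+ i <= S) -> `|s| <= r ->
  series (fun i => c i * s ^+ i) @ \oo --> l ->
  `|l - \sum_(0 <= i < N) c i * s ^+ i| <= S * (`|s| / r) ^+ N.
Proof.
move=> r0 cS sr cl.
have cl' : (fun n => `|series (fun i => c i * s ^+ i) n - \sum_(0 <= i < N) c i * s ^+ i|)
    @ \oo --> `|l - \sum_(0 <= i < N) c i * s ^+ i|.
  by apply: cvg_norm; apply: cvgB => //; exact: cvg_cst.
apply: (cvgr_to_le cl'); exists N => // n /= Nn.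
rewrite /series /= (big_cat_nat (leq0n N) Nn)//= addrAC subrr add0r.
apply: (le_trans (ler_norm_sum _ _ _)).
have q0 : 0 <= `|s| / r by rewrite divr_ge0// ltW.
have q1 : `|s| / r <= 1 by rewrite ler_pdivrMr// mul1r.
apply: (@le_trans _ _ (\sum_(N <= i < n) `|c i| * r ^+ i * (`|s| / r) ^+ N)).
  rewrite big_nat [leRHS]big_nat; apply: ler_sum => i /andP[Ni _].
  rewrite normrM normrX -mulrA; apply: ler_wpM2l => //.
  rewrite -[`|s| in leLHS](divfK (lt0r_neq0 r0)) exprMn mulrC.
  apply: ler_wpM2l; first by rewrite exprn_ge0// ltW.
  by rewrite ler_wiXn2l.
rewrite -mulr_suml; apply: ler_wpM2r; first exact: exprn_ge0.
apply: le_trans (cS n); rewrite (big_cat_nat (leq0n N) Nn)//= lerDr.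
by apply: sumr_ge0 => i _; rewrite mulr_ge0// exprn_ge0// ltW.
Qed.

Lemma analytic1_local g t0 : analytic1 g -> 0 <= t0 <= 1 ->
  exists (r : R) (c : nat -> R) (S : R), [/\ 0 < r, 0 <= S &
    forall t N, 0 <= t <= 1 -> `|t - t0| <= r ->
      `|g t - \sum_(0 <= i < N) c i * (t - t0) ^+ i| <= S * (`|t - t0| / r) ^+ N].
Proof.
move=> ag /ag[r [c [S [r0 cS cg]]]]; exists r, c, S; split => //.
  by have := cS 0; rewrite big_nil.
by move=> t N t01 tr; apply: series_tail => //; exact: cg.
Qed.

Lemma analytic1_cvg g t0 (y : nat -> R) : analytic1 g -> 0 <= t0 <= 1 ->
  (forall n, 0 <= y n <= 1) -> y @ \oo --> t0 -> (g \o y) @ \oo --> g t0.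
Proof.
move=> ag t01 y01 yt0; have [r [c [S [r0 S0 gE]]]] := analytic1_local ag t01.
have gt0 : g t0 = c 0.
  have := gE t0 1 t01; rewrite subrr normr0 => /(_ (ltW r0)).
  by rewrite mul0r mulr0 big_nat1 mulr1 normr_le0 subr_eq0 => /eqP.
apply/cvgrPdist_le => e e0.
have d0 : 0 < Num.min r (e * r / (1 + S)).
  by rewrite lt_min r0 divr_gt0 ?mulr_gt0// ltr_pwDl.
move/cvgrPdist_le : yt0 => /(_ _ d0); apply: filterS => n /=.
rewrite le_min distrC => /andP[ynr yne]; rewrite distrC.
have := gE (y n) 1 (y01 n) ynr; rewrite big_nat1 mulr1 -gt0 => /le_trans; apply.
rewrite expr1 mulrA ler_pdivrMr//.
move: yne; rewrite ler_pdivlMr ?ltr_pwDl// => h; apply: le_trans h.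
by rewrite mulrC ler_wpM2l// lerDr.
Qed.

(** Either all coefficients at t0 vanish, or the first nonzero one, of index N,
    dominates near t0, the remainder being of order N + 1. *)
Lemma analytic1_zeros_local g t0 : analytic1 g -> 0 <= t0 <= 1 ->
  exists2 d : R, 0 < d &
    (forall t, 0 <= t <= 1 -> `|t - t0| < d -> g t = 0) \/
    (forall t, 0 <= t <= 1 -> `|t - t0| < d -> t != t0 -> g t != 0).
Proof.
move=> ag t01; have [r [c [S [r0 S0 gE]]]] := analytic1_local ag t01.
have [c0|] := pselect (forall i, c i = 0).
  exists r => //; left => t tI tr; apply/eqP; rewrite -normr_le0.
  have q1 : `|t - t0| / r < 1 by rewrite ltr_pdivrMr// mul1r.
  have q0 : 0 <= `|t - t0| / r by rewrite divr_ge0// ltW.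
  have : (fun n => S * (`|t - t0| / r) ^+ n) @ \oo --> S * 0.
    by apply: cvgMr; apply: cvg_expr; rewrite ger0_norm.
  rewrite mulr0 => /cvgr_to_ge; apply; exists 0%N => // n _ /=.
  have := gE t n tI (ltW tr).
  by rewrite big1 ?subr0// => i _; rewrite c0 mul0r.
move=> /existsNP/cid[i0 /eqP ci0].
have exN : exists i, c i != 0 by exists i0.
case: (ex_minnP exN) => N cN Nmin.
have cltN i : (i < N)%N -> c i = 0.
  by move=> iN; apply/eqP; apply: contraTT iN => /Nmin; rewrite -leqNgt.
(* Near t0, g t = c N * s ^+ N up to K * s ^+ N.+1 for s = t - t0, so g t = 0 would give
   c N <= K * s in absolute values. *)
pose K := S / r ^+ N.+1.
have K0 : 0 <= K by rewrite divr_ge0// exprn_ge0// ltW.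
pose d := Num.min r (`|c N| / (1 + K)).
have d0 : 0 < d by rewrite lt_min r0 divr_gt0 ?normr_gt0// ltr_pwDl.
exists d => //; right => t tI; rewrite lt_min => /andP[tr td] tt0; apply/eqP => gt0.
have s0 : 0 < `|t - t0| by rewrite normr_gt0 subr_eq0.
have := gE t N.+1 tI (ltW tr).
rewrite gt0 sub0r normrN big_nat_recr//= big_nat big1 ?add0r; last first.
  by move=> i /andP[_ iN]; rewrite cltN// mul0r.
have -> : S * (`|t - t0| / r) ^+ N.+1 = K * `|t - t0| * `|t - t0| ^+ N.
  by rewrite /K expr_div_n [`|t - t0| ^+ N.+1]exprS; move: (_ ^- _) => z; ring.
rewrite normrM normrX ler_pM2r ?exprn_gt0// => h.
move: td; rewrite ltr_pdivlMr ?ltr_pwDl// ltNge => /negP; apply.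
by apply: (le_trans h); rewrite mulrC ler_wpM2l// lerDr.
Qed.

(** Infinitely many zeros accumulate at a point of [0, 1], near which the function
    must vanish identically.  The set of such points is open in [0, 1], and
    closed because a limit of zeros is again such a point, so by connectedness
    it is all of [0, 1]. *)
Lemma analytic1_zeros g : analytic1 g ->
  (forall t, 0 <= t <= 1 -> g t = 0) \/ finite_set [set t | 0 <= t <= 1 /\ g t = 0].
Proof.
move=> ag; set Z := [set t | _].
have [finZ|infZ] := pselect (finite_set Z); [by right|left].
pose I : set R := `[0, 1]%classic.
have I01 t : (0 <= t <= 1) <-> I t by rewrite /I /= in_itv.
pose O := [set t0 : R | exists2 d : R, 0 < d &
  forall t, 0 <= t <= 1 -> `|t - t0| < d -> g t = 0].
have accZ t0 : limit_point (Z : set R) t0 -> (I `&` O) t0.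
  move=> Zt0; have It0 : I t0.
    have : closure I t0.
      apply: (closureS (A := Z)); last exact: subset_limit_point.
      by move=> t [t01 _]; exact/I01.
    by rewrite -(closure_id I).1//; exact: itv_closed.
  split => //.
  have [d d0 [//|gN0]] := analytic1_zeros_local ag ((I01 _).2 It0); first by exists d.
  have [|y [yt0 [y01 gy]]] := Zt0 (ball t0 d); first exact: nbhsx_ballx.
  rewrite /ball/= distrC => yd.
  by have := gN0 _ y01 yd yt0; rewrite gy eqxx.
have IOZ : I `&` O `<=` Z.
  move=> t [/I01 t01 [d d0 gd]]; split => //.
  by apply: gd => //; rewrite subrr normr0.
suff IO : I `&` O = I.
  by move=> t /I01; rewrite -IO => /IOZ[].
apply: (@segment_connected R 0 1).
- have [|t Zt] := @infinite_bounded_limit_point_nonempty R Z infZ.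
    exists 1; split => // M M1 t [/andP[t0 t1] _].
    by rewrite /= ger0_norm// (le_trans t1)// ltW.
  by exists t; exact: accZ.
- exists O => //; rewrite openE => t0 [d d0 gd].
  apply/nbhs_ballP; exists (d / 2); first by rewrite /= divr_gt0.
  move=> y; rewrite /ball/= => yd; exists (d / 2); first by rewrite divr_gt0.
  move=> t t01 td; apply: gd => //.
  rewrite -(subrK y t) -addrA (le_lt_trans (ler_normD _ _))//.
  by rewrite [ltRHS](splitr d) ltrD// distrC.
- exists (closure (I `&` O)); first exact: closed_closure.
  apply/seteqP; split=> [t IOt|t [It clt]].
    by split; [exact: IOt.1|exact: subset_closure].
  have [//|nIOt] := pselect ((I `&` O) t).
  apply: accZ => U /clt[y [IOy Uy]]; exists y; split => //; last exact: IOZ.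
  by apply/eqP => yt; apply: nIOt; rewrite -yt.
Qed.

End Analytic1.

(** * Functions of several variables with analytic slices *)

(** Composing with this retraction onto [0, 1] gives functions defined on the
    whole line without changing them on the interval, and keeps them continuous. *)
Definition clamp (R : realType) (s : R) : R := Num.max 0 (Num.min s 1).

Section Clamp.
Variable R : realType.
Implicit Types s : R.

Lemma clamp_itv s : 0 <= clamp s <= 1.
Proof. by rewrite /clamp le_max lexx ge_max ler01 ge_min lexx orbT. Qed.

Lemma clamp_id s : 0 <= s <= 1 -> clamp s = s.
Proof. by move=> /andP[s0 s1]; rewrite /clamp (min_idPl s1) (max_idPr s0). Qed.

Lemma clampK s : clamp (clamp s) = clamp s.
Proof. exact/clamp_id/clamp_itv. Qed.

Lemma measurable_clamp : measurable_fun setT (@clamp R).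
Proof. by apply: measurable_maxr => //; exact: measurable_minr. Qed.

End Clamp.

(** P holds along each line parallel to a coordinate axis.  The recursion fixes the
    first coordinate or all the others, which suits inductions on the number of
    coordinates. *)
Fixpoint slicewise (R : Type) (P : (R -> R) -> Prop) (k : nat) :
    (k.-tuple R -> R) -> Prop :=
  match k with
  | 0 => fun _ => True
  | k'.+1 => fun h : k'.+1.-tuple R -> R =>
      (forall t : k'.-tuple R, P (fun s => h [tuple of s :: t])) /\
      (forall s, @slicewise R P k' (fun t => h [tuple of s :: t]))
  end.
Arguments slicewise {R} P k h.

Definition set_coord (T : Type) k (x : k.-tuple T) (j : 'I_k) (s : T) : k.-tuple T :=
  [tuple if i == j then s else tnth x i | i < k].

Lemma slicewiseP (R : nmodType) (P : (R -> R) -> Prop) k (h : k.-tuple R -> R) :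
  (forall x j, P (fun s => h (set_coord x j s))) -> slicewise P k h.
Proof.
elim: k h => [//|k IH] h hP; split => [t|s].
  rewrite (_ : (fun s => _) = fun s => h (set_coord [tuple of 0 :: t] ord0 s)) //.
  apply/funext => s; congr h; apply: eq_from_tnth => i; rewrite tnth_mktuple.
  by case: (unliftP ord0 i) => [j|] ->; rewrite ?tnthS// tnth0.
apply: IH => t j.
rewrite (_ : (fun s => _) =
  fun s' => h (set_coord [tuple of s :: t] (lift ord0 j) s')) //.
apply/funext => s'; congr h; apply: eq_from_tnth => i; rewrite tnth_mktuple.
case: (unliftP ord0 i) => [l|] ->; last by rewrite !tnth0.
by rewrite !tnthS tnth_mktuple (inj_eq lift_inj).
Qed.

Section Slice.
Variable R : realType.

Definition cube_analytic (g : R -> R) :=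
  analytic1 g /\ forall s, g (clamp s) = g s.

Definition grid (n : nat) (s : R) : R :=
  (Num.floor (n.+1%:R * clamp s))%:~R / n.+1%:R.

Lemma grid_itv n s : 0 <= grid n s <= 1.
Proof.
have /andP[c0 c1] := clamp_itv s.
rewrite /grid divr_ge0//= ?ler0z ?floor_ge0 ?mulr_ge0//.
rewrite ler_pdivrMr// mul1r (le_trans (ge_floor _))//.
by rewrite -[leRHS]mulr1 ler_wpM2l.
Qed.

Lemma grid_cvg s : grid ^~ s @ \oo --> clamp s.
Proof.
apply/cvgrPdist_lt => e e0; near=> n.
have n0 : 0 < n.+1%:R :> R by [].
have fl := ge_floor (n.+1%:R * clamp s); have fu := lt_succ_floor (n.+1%:R * clamp s).
have -> : clamp s - grid n s =
    (n.+1%:R * clamp s - (Num.floor (n.+1%:R * clamp s))%:~R) / n.+1%:R.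
  by rewrite /grid mulrBl mulrAC divff ?mul1r// lt0r_neq0.
rewrite ger0_norm; last by rewrite divr_ge0// subr_ge0.
apply: (@lt_trans _ _ n.+1%:R^-1); last first.
  by near: n; exact: near_infty_natSinv_lt (PosNum e0).
rewrite -[ltRHS]mul1r ltr_pM2r ?invr_gt0// ltrBlDl.
by rewrite intrD1 in fu *.
Unshelve. all: by end_near. Qed.

Notation pt k := (k.-tuple (measurableTypeR R)).

(** Separate continuity suffices.  Rounding the first coordinate down to a grid
    gives functions that are measurable by induction, being made of countably
    many functions of the other coordinates, and they converge by continuity in
    the first coordinate. *)
Lemma slicewise_measurable k (h : pt k -> R) :
  slicewise cube_analytic k h -> measurable_fun setT h.
Proof.
elim: k h => [|k IH] h.
  move=> _; rewrite (_ : h = cst (h [tuple])); first exact: measurable_cst.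
  by apply/funext => x /=; rewrite (tuple0 x).
move=> [h1 hk].
pose hn n (x : pt k.+1) : R :=
  h [tuple of grid n (thead x) :: [tuple of behead x]].
apply: (@measurable_fun_cvg _ _ _ _ hn) => [n|x _]; last first.
  rewrite [in X in _ --> X](tuple_eta x).
  have [ag gc] := h1 [tuple of behead x].
  rewrite -gc.
  exact: analytic1_cvg ag (clamp_itv (thead x)) (fun n => grid_itv n _)
    (@grid_cvg (thead x)).
move=> _ Y mY; rewrite setTI.
pose B (z : int) := [set x : pt k.+1 |
   (Num.floor (n.+1%:R * clamp (thead x)) = z) /\
   Y (h [tuple of z%:~R / n.+1%:R :: [tuple of behead x]])].
have -> : hn n @^-1` Y = \bigcup_z B z.
  apply/seteqP; split => [x Yx|x [z _ [<- //]]].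
  by exists (Num.floor (n.+1%:R * clamp (thead x))).
apply: countable_bigcupT_measurable => // z.
pose scaled (x : pt k.+1) : R := n.+1%:R * clamp (thead x).
have mscaled : measurable_fun setT scaled.
  apply: measurable_funM => //; apply: measurableT_comp; first exact: measurable_clamp.
  exact: measurable_tnth.
have -> : B z = scaled @^-1` `[z%:~R, (z + 1)%:~R[%classic `&`
    (fun x : pt k.+1 => [tuple of behead x]) @^-1`
      ((fun t : pt k => h [tuple of z%:~R / n.+1%:R :: t]) @^-1` Y).
  apply/seteqP; split => x [/= xz Yx]; split => //.
    by rewrite in_itv/= -xz; exact: floor_itv.
  by apply/floor_def; move: xz; rewrite in_itv.
apply: measurableI.
  by rewrite -[X in measurable X]setTI; apply: mscaled => //; exact: measurable_itv.
rewrite -[X in measurable X]setTI; apply: measurable_behead => //.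
by rewrite -[X in measurable X]setTI; apply: (IH _ (hk _)).
Qed.

(** If h (s0 :: t0) is nonzero, then h (s :: t0) is nonzero for all but finitely
    many s in [0, 1], and for these s the section h (s :: _) falls under the
    second case of the induction hypothesis. *)
Lemma slicewise_zeros k (h : k.-tuple R -> R) : slicewise cube_analytic k h ->
  (forall x, h x = 0) \/
  pow_null finite_set k [set x | (forall j, 0 <= tnth x j <= 1) /\ h x = 0].
Proof.
elim: k h => [|k IH] h.
  move=> _; have [h0|h0] := eqVneq (h [tuple]) 0.
    by left => x; rewrite tuple0.
  right; rewrite /= -subset0 => x [_]; rewrite (tuple0 x) => /eqP.
  by rewrite (negbTE h0).
move=> [h1 hk].
have [h0|] := pselect (forall (s : R) (t : k.-tuple R), h [tuple of s :: t] = 0).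
  by left => x; rewrite (tuple_eta x).
move=> /existsNP[s0 /existsNP[t0 hst]]; right => /=.
have [ag gc] := h1 t0.
have [g0|] := analytic1_zeros ag; first by case: hst; rewrite -gc g0// clamp_itv.
apply: sub_finite_set => s /= ns.
have sI : 0 <= s <= 1.
  apply: contrapT => nsI; apply: ns; rewrite (_ : [set _ | _] = set0).
    by apply: pow_null0 => // A B AB; exact: sub_finite_set.
  by rewrite -subset0 => t [/(_ ord0)]; rewrite tnth0.
split => //; have [->//|ht] := IH _ (hk s).
case: ns; apply: pow_null_sub ht; first by move=> A B AB; exact: sub_finite_set.
move=> t [tI ht]; split => // j; have := tI (lift ord0 j).
by rewrite tnthS.
Qed.

End Slice.

(** * Restricting a multiple power series to a coordinate line *)

Lemma esum_reindex_supp (R : realType) (T T' : choiceType) (e : T -> T')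
    (F : T' -> \bar R) : injective e -> (forall a, ~ range e a -> F a = 0%E) ->
  (\esum_(a in [set: T']) F a = \esum_(i in [set: T]) F (e i))%E.
Proof.
move=> e_inj F0; rewrite -(esum_image setT e F); last by move=> i j _ _; exact: e_inj.
rewrite [RHS]esum_mkcond; apply: eq_esum => a _.
by case: ifPn => // /negP aN; rewrite F0// => ra; apply: aN; rewrite inE.
Qed.

(** For indices in nat, the unordered sum given by positive and negative parts is
    the limit of the partial sums. *)
Lemma summable_series_cvg (R : realType) (u : nat -> R) (l : R) :
  summable setT (EFin \o u) ->
  (l%:E = esum setT (EFin \o u)^\+ - esum setT (EFin \o u)^\-)%E ->
  series u @ \oo --> l.
Proof.
move=> su lE.
have ul : (\sum_(i <oo) (u i)%:E = l%:E)%E.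
  have TE : [set: nat] = (fun i => xpredT i) by apply/seteqP; split.
  rewrite TE in su lE.
  by rewrite lE; exact: (summable_eseries_esum (P := xpredT) su).
have cu : cvgn (series u).
  apply: normed_cvg; apply: nondecreasing_is_cvgn.
    by apply: nondecreasing_series => i _ _ /=.
  exists (fine (\esum_(i in [set: nat]) `|(u i)%:E|)%E) => _ [n _ <-].
  rewrite -lee_fin fineK; last by rewrite -summableE.
  rewrite -nneseries_esumT//; apply: le_trans (nneseries_lim_ge n _) => //.
  by rewrite /series /= -sumEFin.
have : (limn (series u))%:E = l%:E.
  rewrite -EFin_lim// -ul; congr (limn _); apply/funext => n.
  by rewrite /= /series /= -sumEFin.
by move=> [<-].
Qed.

Lemma summable_partial_le (R : realType) (u : nat -> R) n :
  summable setT (EFin \o u) ->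
  \sum_(0 <= i < n) `|u i| <= fine (\esum_(i in [set: nat]) `|(u i)%:E|)%E.
Proof.
move=> su; rewrite -lee_fin fineK; last by rewrite -summableE.
rewrite -nneseries_esumT//; apply: le_trans (nneseries_lim_ge n _) => //.
by rewrite -sumEFin.
Qed.

Section Line.
Variables (R : realType) (k : nat) (f : 'rV[R]_k -> R).
Hypothesis f_analytic : real_analytic_on (unit_cube R k) f.

Definition line (x : 'rV[R]_k) (j : 'I_k) (t : R) : 'rV[R]_k :=
  \row_i if i == j then t else x ord0 i.

(** The series is centred at a point of the line itself, so a monomial involving
    any other coordinate vanishes along the line, and only the pure powers of
    the j-th coordinate contribute. *)
Lemma analytic1_line x j : unit_cube R k x -> analytic1 (fun t => f (line x j t)).
Proof.
move=> Dx t0 t01.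
have Dl t : 0 <= t <= 1 -> unit_cube R k (line x j t).
  by move=> tI i; rewrite mxE; case: ifP => // _; exact: Dx.
have [U [c [Uo Up sumU fU]]] := f_analytic (Dl _ t01).
have /nbhs_ballP[e /= e0 eU] : nbhs (line x j t0) U by exact: open_nbhs_nbhs.
have lU t : `|t - t0| < e -> U (line x j t).
  move=> te; apply: eU; split => // a i; rewrite !mxE; case: ifP => _.
    by rewrite /ball/= distrC.
  exact: ballxx.
(* The multi-indices of the pure powers of the j-th coordinate. *)
pose axis (m : nat) : {ffun 'I_k -> nat} := [ffun i => if i == j then m else 0%N].
have axis_inj : injective axis.
  by move=> m m' /ffunP/(_ j); rewrite !ffunE eqxx.
have termE t m : power_series_term c (line x j t0) (line x j t) (axis m) =
    (c (axis m) * (t - t0) ^+ m)%:E.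
  rewrite /power_series_term (bigD1 j)//= !mxE ffunE eqxx big1 ?mulr1// => i ij.
  by rewrite ffunE (negbTE ij).
have term0 t a : ~ range axis a ->
    power_series_term c (line x j t0) (line x j t) a = 0%E.
  move=> aN; rewrite /power_series_term.
  have [i ij ai] : exists2 i, i != j & a i != 0%N.
    apply: contrapT => nex; apply: aN; exists (a j) => //; apply/ffunP => i.
    rewrite ffunE; case: eqVneq => [->//|ij]; apply/esym/eqP.
    by apply/negP => /negP ai; apply: nex; exists i.
  by rewrite (bigD1 i)//= !mxE (negbTE ij) subrr expr0n (negbTE ai) mul0r mulr0.
pose u t (m : nat) := c (axis m) * (t - t0) ^+ m.
have sumu t : `|t - t0| < e -> summable setT (EFin \o u t).
  move=> /lU/sumU; rewrite /summable (esum_reindex_supp axis_inj); last first.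
    by move=> a /term0 ->; rewrite abse0.
  by under eq_esum do rewrite termE.
(* The absolute bound is taken at t0 + e / 2, which lies in U, where the series is
   summable, though possibly outside the cube. *)
exists (e / 2), (c \o axis), (fine (\esum_(i in [set: nat]) `|(u (t0 + e / 2) i)%:E|)%E).
have e20 : 0 < e / 2 by rewrite divr_gt0.
have e2e : e / 2 < e by rewrite ltr_pdivrMr// ltr_pMr// ltr1n.
split => // [n|t tI te].
  have te : `|t0 + e / 2 - t0| < e by rewrite addrAC subrr add0r gtr0_norm.
  apply: le_trans (summable_partial_le n (sumu _ te)).
  apply: ler_sum => i _; rewrite /u addrAC subrr add0r normrM.
  by rewrite (ger0_norm (exprn_ge0 _ (ltW e20))).
have {}te := le_lt_trans te e2e.
apply: (@summable_series_cvg _ (u t)); first exact: sumu.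
rewrite (fU _ (lU _ te) (Dl _ tI)); congr (_ - _)%E; rewrite (esum_reindex_supp axis_inj).
- by apply: eq_esum => m _; rewrite !funeposE termE.
- by move=> a /term0 t0E; rewrite funeposE t0E maxxx.
- by apply: eq_esum => m _; rewrite !funenegE termE.
- by move=> a /term0 t0E; rewrite funenegE t0E oppe0 maxxx.
Qed.

End Line.

Definition clamp_row (R : realType) k (x : k.-tuple R) : 'rV[R]_k :=
  \row_j clamp (tnth x j).

Lemma analytic1_ext (R : realType) (g h : R -> R) :
  (forall t, 0 <= t <= 1 -> g t = h t) -> analytic1 g -> analytic1 h.
Proof.
move=> gh ag t0 /ag[r [c [S [r0 cS cg]]]]; exists r, c, S; split => // t tI tr.
by rewrite -gh//; exact: cg.
Qed.

Lemma unit_cube_clamp_row (R : realType) k (x : k.-tuple R) :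
  unit_cube R k (clamp_row x).
Proof. by move=> j; rewrite mxE clamp_itv. Qed.

(** Linear combinations are formed on the slices, where the power series are
    ordinary ones and can simply be added. *)
Lemma slicewise_comb (R : realType) k (I : finType) (f : I -> 'rV[R]_k -> R)
    (a : I -> R) :
  (forall i, real_analytic_on (unit_cube R k) (f i)) ->
  slicewise (@cube_analytic R) k (fun x => \sum_i a i * f i (clamp_row x)).
Proof.
move=> fa; apply: slicewiseP => x j.
have rowE s : clamp_row (set_coord x j s) = line (clamp_row x) j (clamp s).
  by apply/rowP => i; rewrite !mxE tnth_mktuple; case: ifP.
split => [|s]; last first.
  by apply: eq_bigr => i _; rewrite !rowE clampK.
apply: (@analytic1_ext _ (fun t => \sum_i a i * f i (line (clamp_row x) j t))).
  by move=> t tI; apply: eq_bigr => i _; rewrite rowE clamp_id.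
apply: analytic1_sum => i; apply: analytic1_line => //.
exact: unit_cube_clamp_row.
Qed.

(** * Independence of random vectors outside a null set *)

Section GenericRank.
Variables (K : fieldType) (T : Type) (I : set (set T)) (D : set T) (m : nat).
Variable F : T -> 'rV[K]_m.
Hypothesis I0 : I set0.
Hypothesis I_sub : forall A B, A `<=` B -> I B -> I A.
Hypothesis F_null : forall c : 'cV_m, c != 0 -> I [set x | D x /\ F x *m c = 0].

(** A proper subspace is contained in the kernel of a nonzero linear form. *)
Lemma null_submx (A : 'M[K]_m) : (\rank A < m)%N -> I [set x | D x /\ (F x <= A)%MS].
Proof.
move=> rA.
have coker0 : cokermx A != 0 by rewrite -mxrank_eq0 mxrank_coker -lt0n subn_gt0.
have [j cj] : exists j, col j (cokermx A) != 0.
  apply: contrapT => c0; case/eqP: coker0; apply/matrixP => i j.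
  rewrite [RHS]mxE; apply/eqP; apply: contra_notT c0 => cij.
  exists j; apply: contraNneq cij => /colP/(_ i); rewrite !mxE => ->.
  by rewrite eqxx.
apply: I_sub (F_null cj) => x [Dx]; rewrite submxE => /eqP FA.
by split => //; rewrite colE mulmxA FA mul0mx.
Qed.

Definition rank_defect N (J : 'I_N -> bool) (A : 'M[K]_m) : set (N.-tuple T) :=
  [set q | (forall i, D (tnth q i)) /\
    (\rank (A + \sum_(i | J i) <<F (tnth q i)>>)%MS < \rank A + \sum_i J i)%N].

(** The components with J true, together with A, are expected to be independent.
    Take the first component: either it is skipped, or outside a null set it
    increases the rank of A by one.  Then the remaining components are treated
    with the enlarged A, which is why A is arbitrary. *)
Lemma pow_null_rank N (J : 'I_N -> bool) (A : 'M[K]_m) :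
  (\rank A + \sum_i J i <= m)%N -> pow_null I N (rank_defect J A).
Proof.
elim: N J A => [|N IH] J A rm.
  rewrite /= -subset0 => q [_]; rewrite !big_ord0 addn0 ltnNge => /negP; apply.
  by rewrite mxrankS// addsmxSl.
pose J' i := J (lift ord0 i).
pose A' x := if J ord0 then (A + <<F x>>)%MS else A.
have rA' x : (\rank (A' x) <= \rank A + J ord0)%N.
  rewrite /A'; case: (J ord0); last by rewrite addn0.
  apply: (leq_trans (mxrank_adds_leqif _ _).1); rewrite leq_add2l genmxE.
  exact: rank_leq_row.
have good x : ~ (\rank (A' x) < \rank A + J ord0)%N ->
    pow_null I N [set t : N.-tuple T | rank_defect J A [tuple of x :: t]].
  move=> /negP; rewrite -leqNgt => rA.
  have {rA} rA : \rank (A' x) = (\rank A + J ord0)%N by apply/eqP; rewrite eqn_leq rA' rA.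
  have rm' : (\rank (A' x) + \sum_i J' i <= m)%N.
    by rewrite rA -addnA; move: rm; rewrite big_ord_recl.
  apply: pow_null_sub (IH J' (A' x) rm') => // t [Dt] /=.
  rewrite big_mkcond/= !big_ord_recl/= tnth0 addnA -rA => h; split.
    move=> i; by rewrite -(tnthS x t i); exact: Dt.
  apply: leq_ltn_trans h; rewrite mxrankS// [X in (_ + X <= _)%MS]big_mkcond/=.
  under [X in (_ + X <= _)%MS]eq_bigr => i _ do rewrite -(tnthS x t i).
  rewrite /A'; case: (J ord0); first by rewrite addsmxA.
  by rewrite addsmxS// addsmxSr.
rewrite /=.
case J0 : (J ord0); last first.
  apply: I_sub I0 => x; apply; apply: good; rewrite /A' J0 addn0 ltnn; exact.
have rAm : (\rank A < m)%N.
  by apply: leq_trans rm; rewrite big_ord_recl J0 addnA addn1 leq_addr.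
apply: I_sub (null_submx rAm) => x nx; split.
  apply: contrapT => nDx; apply: nx; apply: pow_null_sub (pow_null0 _ _ _) => //.
  by move=> t [/(_ ord0)]; rewrite tnth0.
have := contra_not (good x) nx => /contrapT; rewrite /A' J0 addn1 ltnS => rx.
have := (mxrank_leqif_sup (addsmxSl A <<F x>>%MS)).2.
rewrite eqn_leq rx mxrankS ?addsmxSl//= => /esym; rewrite addsmx_sub genmxE.
by case/andP.
Qed.

End GenericRank.

(** * Samples in general position *)

Lemma measurable_det d (T : measurableType d) (R : realType) n (M : T -> 'M[R]_n) :
  (forall i j, measurable_fun setT (fun x => M x i j)) ->
  measurable_fun setT (fun x => \det (M x)).
Proof.
move=> mM; rewrite /determinant; apply: measurable_sum => s.
by apply: measurable_funM => //; apply: measurable_prod => i _.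
Qed.

Lemma measurable_forall d (T : measurableType d) (I : finType) (A : I -> set T) :
  (forall i, measurable (A i)) -> measurable [set x | forall i, A i x].
Proof.
move=> mA; rewrite (_ : [set x | _] = \bigcap_i A i).
  by apply: fin_bigcap_measurable => //; exact: finite_finset.
by apply/seteqP; split => x h i => [_|]; exact: h.
Qed.

Lemma count_option_image N n (s : 'I_n -> option 'I_N) : injective s ->
  ((None \in codom s) + \sum_(i < N) (Some i \in codom s))%N = n.
Proof.
move=> s_inj; rewrite -[RHS](card_ord n) -(card_codom s_inj) [RHS](cardD1 None).
congr (_ + _)%N; transitivity #|[pred i | Some i \in codom s]|.
  rewrite -sum1_card [RHS]big_mkcond; apply: eq_bigr => i _.
  by rewrite inE; case: (_ \in _).
have Some_inj : injective (@Some 'I_N) by move=> i j [].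
rewrite -(fintype.card_image Some_inj); apply: eq_card => -[i|]; rewrite !inE/=.
  by rewrite (fintype.mem_image Some_inj).
by apply/negP => /fintype.imageP[].
Qed.

Section Sample.
Variables (R : realType) (k n N : nat) (f : 'I_n.+1 -> 'rV[R]_k -> R).
Hypothesis f_analytic : forall i, real_analytic_on (unit_cube R k) (f i).
Hypothesis f_indep : linearly_independent_on (unit_cube R k) f.

Notation point := (k.-tuple (measurableTypeR R)).

Definition in_cube : set point := [set x | forall j, 0 <= (tnth x j : R) <= 1].

Definition value_row (x : point) : 'rV[R]_n.+1 := \row_j f j (clamp_row x).

Lemma clamp_row_id (x : point) : in_cube x -> clamp_row x = \row_j (tnth x j : R).
Proof. by move=> xD; apply/rowP => j; rewrite !mxE clamp_id. Qed.

Let I_sub m (A B : set (m.-tuple R)) : A `<=` B ->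
  pow_null finite_set m B -> pow_null finite_set m A.
Proof. by apply: pow_null_sub => A' B' AB; exact: sub_finite_set. Qed.

Lemma value_row_null (c : 'cV[R]_n.+1) : c != 0 ->
  pow_null finite_set k [set x | in_cube x /\ value_row x *m c = 0].
Proof.
move=> c0.
have mE x : (value_row x *m c) 0 0 = \sum_i c i 0 * f i (clamp_row x).
  by rewrite mxE; apply: eq_bigr => i _; rewrite mxE mulrC.
have [h0|] := slicewise_zeros (slicewise_comb (fun i => c i 0) f_analytic).
  case/eqP: c0; apply/colP => i; rewrite [RHS]mxE.
  apply: (f_indep (c := fun i => c i 0)) => x xD.
  have -> : x = clamp_row [tuple x ord0 j | j < k].
    by apply/rowP => j; rewrite mxE tnth_mktuple clamp_id.
  exact: h0.
by apply: I_sub => x [xD cx]; split=> //; rewrite -mE cx mxE.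
Qed.

Lemma measurable_value_row j : measurable_fun setT (fun x : point => value_row x ord0 j).
Proof.
rewrite (_ : (fun x => _) = fun x : point => \sum_i (i == j)%:R * f i (clamp_row x)).
  apply: slicewise_measurable.
  exact: (slicewise_comb (fun i => (i == j)%:R) f_analytic).
apply/funext => x; rewrite mxE (bigD1 j)//= eqxx mul1r big1 ?addr0// => i ij.
by rewrite (negbTE ij) mul0r.
Qed.

(** The index [None] stands for the first unit vector, which fixes the coefficient
    of f_0. *)
Definition augmented_row (q : sample_space R k N) (o : option 'I_N) : 'rV[R]_n.+1 :=
  if o is Some i then value_row (tnth q i) else delta_mx ord0 ord0.

Definition samples_in_cube : set (sample_space R k N) :=
  [set q | forall i, in_cube (tnth q i)].

Definition degenerate (s : 'I_n.+1 -> option 'I_N) : set (sample_space R k N) :=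
  [set q | samples_in_cube q /\ \det (\matrix_i augmented_row q (s i)) = 0].

Lemma measurable_samples_in_cube : measurable samples_in_cube.
Proof.
apply: (measurable_forall (A := fun i => [set q | in_cube (tnth q i)])) => i.
apply: (measurable_forall (A := fun j => [set q : sample_space R k N |
  0 <= (tnth (tnth q i) j : R) <= 1])) => j.
have mij : measurable_fun setT (fun q : sample_space R k N => tnth (tnth q i) j).
  exact: measurableT_comp (measurable_tnth j) (measurable_tnth i).
rewrite (_ : [set q | _] =
  (fun q : sample_space R k N => tnth (tnth q i) j) @^-1` `[0, 1]%classic).
  by rewrite -[X in measurable X]setTI; apply: mij => //; exact: measurable_itv.
by apply/seteqP; split => q /=; rewrite in_itv.
Qed.

Lemma measurable_degenerate s : measurable (degenerate s).
Proof.
have -> : degenerate s = samples_in_cube `&`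
    (fun q => \det (\matrix_i augmented_row q (s i))) @^-1` [set 0] by [].
apply: measurableI; first exact: measurable_samples_in_cube.
rewrite -[X in measurable X]setTI; apply: measurable_det => //.
move=> i j; under eq_fun do rewrite mxE.
case: (s i) => [a|] /=; last exact: measurable_cst.
by apply: (measurableT_comp (measurable_value_row j)); exact: measurable_tnth.
Qed.

(** If s takes the value [None], the unit vector is the initial matrix A of
    [pow_null_rank]; otherwise A is zero. *)
Lemma degenerate_null s : injective s ->
  pow_null (pow_null finite_set k) N (degenerate s).
Proof.
move=> s_inj.
pose J i := Some i \in codom s.
pose A : 'M[R]_n.+1 :=
  if None \in codom s then <<delta_mx ord0 ord0 : 'rV_n.+1>>%MS else 0.
have rA : \rank A = (None \in codom s).
  by rewrite /A; case: ifP => _; rewrite ?genmxE ?mxrank_delta ?mxrank0.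
have cnt : (\rank A + \sum_i J i)%N = n.+1 by rewrite rA count_option_image.
have null_sub (B B' : set point) :
    B `<=` B' -> pow_null finite_set k B' -> pow_null finite_set k B.
  exact: I_sub.
have null0 : pow_null finite_set k (set0 : set point).
  by apply: pow_null0 => // A' B' AB; exact: sub_finite_set.
have rank_null : pow_null (pow_null finite_set k) N (rank_defect in_cube value_row J A).
  by apply: (pow_null_rank null0 null_sub value_row_null); rewrite cnt.
apply: pow_null_sub rank_null => // q [qD det0]; split => //.
rewrite cnt ltnNge; apply/negP => full.
have : \matrix_i augmented_row q (s i) \in unitmx.
  rewrite -row_free_unit /row_free eqn_leq rank_leq_row /=.
  apply: (leq_trans full); apply: mxrankS; rewrite addsmx_sub; apply/andP; split.
    rewrite /A; case: ifP => [/codomP[i si]|_]; last exact: sub0mx.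
    rewrite genmxE.
    rewrite (_ : delta_mx _ _ = row i (\matrix_i augmented_row q (s i))) ?row_sub//.
    by rewrite rowK -si.
  apply/sumsmx_subP => a /codomP[i si]; rewrite genmxE.
  rewrite (_ : value_row _ = row i (\matrix_i augmented_row q (s i))) ?row_sub//.
  by rewrite rowK -si.
by rewrite unitmxE det0 unitr0.
Qed.

Variable nu : probability (sample_space R k N) R.
Hypothesis nu_cube : nu [set q | forall i, unit_cube R k (row_point q i)] = 1%E.
Hypothesis nu_ac : nu `<< lebesgue_sample R k N.

Lemma lebesgue_sample_null (A : set (sample_space R k N)) :
  pow_null (pow_null finite_set k) N A -> lebesgue_sample R k N A = 0%E.
Proof.
apply: power_measure_null; first by move=> A' B'; exact: I_sub.
move=> B; apply: power_measure_null; first by move=> A' B' AB; exact: sub_finite_set.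
move=> C finC; apply: countable_lebesgue_measure0; exact: finite_set_countable.
Qed.

Lemma ae_samples_in_cube : {ae nu, forall q, samples_in_cube q}.
Proof.
have mC := measurable_samples_in_cube.
exists (~` samples_in_cube); split => //; first exact: measurableC.
rewrite probability_setC// (_ : nu samples_in_cube = 1%E) ?subee//.
rewrite -nu_cube; congr (nu _); apply/seteqP; split => q h i j.
  by rewrite mxE; exact: h.
by have := h i j; rewrite mxE.
Qed.

(** A finite union over the choices s of n + 1 vectors.  Only here is the
    measurability of the degenerate sets used, since negligible sets must be
    contained in measurable ones. *)
Lemma ae_general_position : {ae nu, forall q, general_position (augmented_row q)}.
Proof.
have gp : {ae nu, forall q, forall s : {ffun 'I_n.+1 -> option 'I_N},
    injective s -> ~ degenerate s q}.
  apply: filter_forall => s.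
  have [s_inj|s_ninj] := pselect (injective s); last exact: nearW.
  exists (degenerate s); split; first exact: measurable_degenerate.
    have /nu_ac : (lebesgue_sample R k N).-null_set (degenerate s).
      move=> A _ AB; apply: lebesgue_sample_null.
      apply: pow_null_sub AB (degenerate_null s_inj).
      by move=> A' B'; exact: I_sub.
    by apply => //; exact: measurable_degenerate.
  by move=> q /=; apply: contra_notP => nd _.
apply: filterS2 ae_samples_in_cube gp => q qD nd s s_inj.
rewrite unitmxE unitfE; apply/eqP => det0; apply: (nd [ffun i => s i]).
  by move=> i j; rewrite !ffunE; exact: s_inj.
split => //; rewrite -[RHS]det0; congr (\det _); apply/matrixP => i j.
by rewrite !mxE ffunE.
Qed.

End Sample.

Lemma maximum_of_general_position (R : realType) (k n N : nat)
    (f : 'I_n.+1 -> 'rV[R]_k -> R) (q : sample_space R k N) :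
  (n < N)%N -> samples_in_cube q -> general_position (augmented_row f q) ->
  let C := positivity_sets (unit_cube R k) (f ord0)
             (linear_span (fun i : 'I_n => f (lift ord0 i))) in
  maximum_of_VC_dim R (range (row_point q)) (strace C (range (row_point q))) n.
Proof.
move=> ltnN qD gp C.
have cubeP i : unit_cube R k (row_point q i) by move=> j; rewrite mxE; exact: qD.
have rowE i : clamp_row (tnth q i) = row_point q i by exact: clamp_row_id.
have valN (u : 'cV[R]_n.+1) : (augmented_row f q None *m u) 0 0 = u ord0 0.
  by rewrite /= -matrix.rowE mxE.
have valS i (u : 'cV[R]_n.+1) : (augmented_row f q (Some i) *m u) 0 0 =
    f ord0 (row_point q i) * u ord0 0 +
    \sum_(j < n) f (lift ord0 j) (row_point q i) * u (lift ord0 j) 0.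
  rewrite /= mxE big_ord_recl !mxE rowE; congr (_ + _).
  by apply: eq_bigr => j _; rewrite mxE rowE.
apply: (maximum_range (v := augmented_row f q)) => //.
- by move=> i j ij /=; rewrite /value_row !rowE ij.
- move=> _ [_ [c ->] <-].
  exists (\col_i if unlift ord0 i is Some j then - c j else 1).
    by rewrite valN mxE unlift_none.
  move=> i; rewrite valS mxE unlift_none mulr1 /=.
  under [in X in _ <-> X]eq_bigr do rewrite mxE liftK mulrN mulrC.
  by rewrite sumrN; split => [[]//|].
- move=> u; rewrite valN => u1.
  pose g x := \sum_(j < n) (- u (lift ord0 j) 0) * f (lift ord0 j) x.
  exists [set x | unit_cube R k x /\ f ord0 x - g x > 0].
    by exists g => //; exists (fun j => - u (lift ord0 j) 0).
  move=> i; rewrite valS u1 mulr1 /=.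
  have <- : - g (row_point q i) =
      \sum_(j < n) f (lift ord0 j) (row_point q i) * u (lift ord0 j) 0.
    by rewrite /g -sumrN; apply: eq_bigr => j _; rewrite mulNr opprK mulrC.
  by split => [[]//|].
Qed.

Theorem corollary3p3 (R : realType) (k n : nat)
    (f : 'I_n.+1 -> 'rV[R]_k -> R)
    (f_analytic : forall i, real_analytic_on (unit_cube R k) (f i))
    (f_indep : linearly_independent_on (unit_cube R k) f)
    (N : nat) (ltnN : (n < N)%N)
    (nu : probability (sample_space R k N) R)
    (nu_cube : nu [set q | forall i, unit_cube R k (row_point q i)] = 1%E)
    (nu_ac : nu `<< lebesgue_sample R k N) :
  let C := positivity_sets (unit_cube R k) (f ord0)
             (linear_span (fun i : 'I_n => f (lift ord0 i))) in
  {ae nu, forall q,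
     let X0 := range (row_point q) in
     maximum_of_VC_dim R X0 (strace C X0) n}.
Proof.
move=> C.
apply: filterS2 (ae_samples_in_cube nu_cube)
  (ae_general_position f_analytic f_indep nu_cube nu_ac) => q.
exact: maximum_of_general_position.
Qed.
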